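(* For $a>0$ and $0\le b\le \pi$ let $$I(a,b):=\int_0^b\arctan\!\left(\frac{a+\cos\beta}{\sin\beta}\right)d\beta ,\qquad \phi_a(b):=I(a,b)-\frac{\pi b}{2}+\frac{b^2}{2},\qquad \psi(a):=\operatorname{Im}\bigl(\operatorname{Li}_2(1+ia)\bigr),$$ where $\operatorname{Li}_2$ denotes the dilogarithm analytically continued on its principal branch. Let $\mathscr{A}:=\{a>0 \,:\, 0<\psi(a)<\phi_a(\pi)\}$. Then $\mathscr{A}\neq\emptyset$, and for every $a\in\mathscr{A}$ there exists a unique $b=b(a)\in(0,\pi)$ such that $$\operatorname{Ti}_2(a)=\arctan(a)\ln(a)+I(a,b)-\frac{\pi b}{2}+\frac{b^2}{2}-\frac{\pi}{4}\ln(a^2+1).$$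
   Context: The inverse tangent integral is $\operatorname{Ti}_2(y):=\int_0^y\frac{\arctan x}{x}\,dx$. The dilogarithm is $\operatorname{Li}_2(z)=\sum_{n\ge1}z^n/n^2$ for $|z|\le1$, analytically continued (principal branch) to a holomorphic function on $\mathbb{C}\setminus[1,\infty)$, with $\frac{d}{dz}\operatorname{Li}_2(z)=-\operatorname{Log}(1-z)/z$, $\operatorname{Log}$ the principal logarithm. The integrand of $I(a,b)$ is understood via its continuous extension at $\beta=0$ (value $\pi/2$) and at $\beta=\pi$; $\arctan$ is the principal real arctangent and $\ln$ the natural logarithm. *)

(* Defs.v *)
(* Stdlib reals with Coquelicot. *)
From Stdlib Require Import Reals Lra.
From Coquelicot Require Import Coquelicot.
Open Scope R_scope.

(* The value of the integrand at the endpoint 0 is immaterial. *)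
Definition Ti2 (y : R) : R := RInt (fun x => atan x / x) 0 y.

(* arctan ((a + cos beta) / sin beta) extended continuously, for a > 0, from
   (0, PI) to [0, PI].  At PI the quotient tends to -infinity, 0 or +infinity
   according as a < 1, a = 1 or a > 1. *)
Definition integrand (a beta : R) : R :=
  if Req_EM_T beta 0 then PI / 2
  else if Req_EM_T beta PI then sign (a - 1) * (PI / 2)
  else atan ((a + cos beta) / sin beta).

Definition Iab (a b : R) : R := RInt (integrand a) 0 b.

Definition phi (a b : R) : R := Iab a b - PI * b / 2 + b ^ 2 / 2.

(* Principal argument, in (-PI, PI]; junk value at 0. *)
Definition Arg (z : C) : R :=
  if Rle_dec 0 (Im z) then acos (Re z / Cmod z) else - acos (Re z / Cmod z).

Definition Log (z : C) : C := (ln (Cmod z), Arg z).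

Lemma Arg_polar (z : C) :
  z <> 0%C ->
  -PI < Arg z <= PI /\
  Re z = Cmod z * cos (Arg z) /\ Im z = Cmod z * sin (Arg z).
Proof.
intros Hz.
assert (Hm : 0 < Cmod z) by (apply Cmod_gt_0; exact Hz).
pose proof (Cmod2_alt z) as H2.
set (c := Re z / Cmod z).
assert (Hre : Re z = Cmod z * c) by (unfold c; field; lra).
assert (Hc : -1 <= c <= 1).
{ pose proof (re_le_Cmod z) as Hr.
  assert (Hn : -Cmod z <= Re z <= Cmod z) by (apply Rabs_le_between; exact Hr).
  split; apply Rmult_le_reg_l with (Cmod z); try exact Hm; rewrite <- Hre; lra. }
pose proof (acos_bound c) as Hb.
assert (Hs : Rabs (Im z) = Cmod z * sin (acos c)).
{ rewrite sin_acos by exact Hc.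
  rewrite <- (sqrt_Rsqr (Cmod z)) at 1 by lra.
  rewrite <- sqrt_mult_alt by apply Rle_0_sqr.
  rewrite <- sqrt_Rsqr_abs. f_equal.
  rewrite Hre in H2. unfold Rsqr. nra. }
pose proof PI_RGT_0 as HPI.
unfold Arg; fold c.
destruct (Rle_dec 0 (Im z)) as [Hi | Hi].
- rewrite Rabs_pos_eq in Hs by exact Hi. rewrite cos_acos by exact Hc.
  repeat split; try lra; exact Hs.
- rewrite Rabs_left in Hs by lra.
  rewrite cos_neg, sin_neg, cos_acos by exact Hc.
  assert (Hne : acos c <> PI).
  { intros E. rewrite E, sin_PI in Hs. lra. }
  repeat split; lra.
Qed.

(* C \ [1, +infinity) *)
Definition slit (z : C) : Prop := ~ (1 <= Re z /\ Im z = 0).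

(* The principal branch of the dilogarithm.  These conditions determine L on
   the slit plane; its values on (1, +infinity) are left unconstrained. *)
Record is_dilogarithm (L : C -> C) : Prop := {
  dilogarithm_series : forall z : C, Cmod z <= 1 ->
    is_series (V := C_NormedModule)
      (fun n : nat => (z ^ S n / RtoC (INR (S n) ^ 2))%C) (L z);
  dilogarithm_holomorphic : forall z : C, slit z ->
    ex_derive (V := C_NormedModule) L z;
  dilogarithm_derive : forall z : C, slit z -> z <> 0%C ->
    is_derive (V := C_NormedModule) L z (- (Log (1 - z) / z))%C
}.

Definition psi (Li2 : C -> C) (a : R) : R := Im (Li2 (1 + Ci * a)%C).

Definition calA (Li2 : C -> C) (a : R) : Prop :=
  0 < a /\ 0 < psi Li2 a < phi a PI.

(* Main.v *)
(* On the line [1 + i a] the function psi has the same derivative as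
   Ti2 a - atan a * ln a + PI / 4 * ln (a ^ 2 + 1), and both tend to 0 as a -> 0+
   (for psi: a short horizontal segment of length a leads into the closed unit
   disc, on which |Im (Li2 z)| <= N * |Im z| + 1 / N for every N >= 1).  So they
   agree, and the equation for b reads phi a b = psi a.  Since
   PI / 2 - x = atan (cos x / sin x), phi a is strictly increasing on [0, PI] and
   vanishes at 0, and the intermediate value theorem applies.  The point a = 1
   lies in calA because phi 1 PI = PI ^ 2 / 4. *)
Require Import Defs.
From Stdlib Require Import Reals Lra Lia.
From Coquelicot Require Import Coquelicot.
Open Scope R_scope.

(** * Complex derivatives along real lines *)

Lemma Rabs_Im_le_Cmod (z : C) : Rabs (Im z) <= Cmod z.
Proof.
  apply Rle_trans with (2 := Rmax_Cmod z). apply Rmax_r.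
Qed.

(** The chain rule from a complex to a real variable, by hand because the scalar field changes. It
    works because [Im] is real-linear and does not increase the modulus, so the complex remainder
    bounds the real one. *)
Lemma is_derive_Im_line (L : C -> C) (z d l : C) (t : R) :
  is_derive (V := C_NormedModule) L (z + d * t)%C l ->
  is_derive (fun s : R => Im (L (z + d * s)%C)) t (Im (d * l)%C).
Proof.
  intros [_ H].
  apply is_derive_Reals. intros eps Heps.
  set (w := (z + d * t)%C) in *.
  assert (Hd : 0 <= Cmod d) by apply Cmod_ge_0.
  (* The [+ 1] covers [d = 0], and the factor 2 makes the final inequality strict. *)
  assert (He : 0 < eps / (2 * (Cmod d + 1))).
  { apply Rdiv_lt_0_compat; lra. }
  destruct (H w (fun P HP => HP) (mkposreal _ He)) as [del Hdel].
  assert (Hdl : 0 < del / (Cmod d + 1)).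
  { apply Rdiv_lt_0_compat; [apply del | lra]. }
  exists (mkposreal _ Hdl). intros h Hh0 Hh. simpl in Hh.
  assert (Hh' : 0 < Rabs h) by (apply Rabs_pos_lt; exact Hh0).
  specialize (Hdel (z + d * (t + h)%R)%C).
  assert (Hdiff : ((z + d * (t + h)%R) - w = d * h)%C).
  { unfold w. rewrite RtoC_plus. ring. }
  assert (Hball : ball (M := AbsRing_UniformSpace C_AbsRing) w del (z + d * (t + h)%R)%C).
  { change (Cmod ((z + d * (t + h)%R) - w)%C < del).
    rewrite Hdiff, Cmod_mult, Cmod_R.
    apply Rle_lt_trans with ((Cmod d + 1) * Rabs h); [nra|].
    apply (Rmult_lt_compat_l (Cmod d + 1)) in Hh; [|lra].
    replace ((Cmod d + 1) * (del / (Cmod d + 1))) with (pos del) in Hh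
      by (field; lra). exact Hh. }
  specialize (Hdel Hball).
  change (Cmod ((L (z + d * (t + h)%R) - L w) - ((z + d * (t + h)%R) - w) * l)%C
     <= eps / (2 * (Cmod d + 1)) * Cmod ((z + d * (t + h)%R) - w)%C) in Hdel.
  rewrite Hdiff, Cmod_mult, Cmod_R in Hdel.
  set (E := ((L (z + d * (t + h)%R) - L w) - (d * h) * l)%C) in *.
  assert (HE : Im E = Im (L (z + d * (t + h)%R)%C) - Im (L w) - h * Im (d * l)%C).
  { unfold E. generalize (L (z + d * (t + h)%R)%C) (L w). intros p q.
    unfold Im; simpl. ring. }
  pose proof (Rabs_Im_le_Cmod E) as HI. rewrite HE in HI.
  set (X := Im (L (z + d * (t + h)%R)%C)) in *.
  set (Y := Im (L w)) in *. set (D := Im (d * l)%C) in *.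
  replace ((X - Y) / h - D) with ((X - Y - h * D) / h) by (field; exact Hh0).
  rewrite Rabs_div by exact Hh0.
  apply Rle_lt_trans with (eps / (2 * (Cmod d + 1)) * Cmod d).
  - apply Rmult_le_reg_r with (Rabs h); [exact Hh'|].
    unfold Rdiv at 1. rewrite Rmult_assoc, Rinv_l by lra. lra.
  - apply Rmult_lt_reg_r with (2 * (Cmod d + 1)); [lra|].
    replace (eps / (2 * (Cmod d + 1)) * Cmod d * (2 * (Cmod d + 1)))
      with (eps * Cmod d) by (field; lra). nra.
Qed.

(** * The imaginary part of the dilogarithm on the closed unit disc *)

Lemma Cmod_pow_le_1 (z : C) (n : nat) : Cmod z <= 1 -> Cmod (z ^ n)%C <= 1.
Proof.
  intros Hz. rewrite Cmod_pow, <- (pow1 n).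
  apply pow_incr. split; [apply Cmod_ge_0 | exact Hz].
Qed.

(** Induction on [Im (z * z ^ n) = Re z * Im (z ^ n) + Im z * Re (z ^ n)], where both real parts
    have absolute value at most 1. *)
Lemma Rabs_Im_pow (z : C) (n : nat) :
  Cmod z <= 1 -> Rabs (Im (z ^ n)%C) <= INR n * Rabs (Im z).
Proof.
  intros Hz. induction n as [|n IH].
  - simpl. rewrite Rabs_R0. lra.
  - rewrite S_INR. change (z ^ S n)%C with (z * z ^ n)%C. rewrite im_mult.
    eapply Rle_trans; [apply Rabs_triang|]. rewrite !Rabs_mult.
    assert (H1 : Rabs (Re z) <= 1) by (eapply Rle_trans; [apply re_le_Cmod | exact Hz]).
    assert (H2 : Rabs (Re (z ^ n)%C) <= 1)
      by (eapply Rle_trans; [apply re_le_Cmod | apply Cmod_pow_le_1, Hz]).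
    pose proof (Rabs_pos (Im (z ^ n)%C)). pose proof (Rabs_pos (Im z)).
    pose proof (Rabs_pos (Re z)). pose proof (Rabs_pos (Re (z ^ n)%C)).
    nra.
Qed.

(** Each of the first [N] terms contributes at most [Rabs (Im z)], since the k-th is at most
    [Rabs (Im z) / k]. Beyond them [1 / k ^ 2 <= 1 / (k - 1) - 1 / k] telescopes to less than
    [/ INR N]. The bound does not depend on [M], so it survives the passage to the limit. *)
Lemma Rabs_Im_sum_dilog (z : C) (N M : nat) :
  Cmod z <= 1 -> (0 < N)%nat ->
  Rabs (Im (sum_n (G := C_NormedModule)
              (fun n => (z ^ S n / RtoC (INR (S n) ^ 2))%C) M))
  <= INR N * Rabs (Im z) + / INR N.
Proof.
  intros Hz HN.
  set (u := fun n => (z ^ S n / RtoC (INR (S n) ^ 2))%C).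
  set (S_ := fun m => Im (sum_n (G := C_NormedModule) u m)).
  assert (Hpos : forall n, 0 < INR (S n)) by (intros; apply lt_0_INR; lia).
  assert (HN0 : 0 < INR N) by (apply lt_0_INR; lia).
  pose proof (Rabs_pos (Im z)) as Hy.
  assert (Hu : forall n, Im (u n) = Im (z ^ S n)%C / INR (S n) ^ 2).
  { intros n. unfold u, Cdiv.
    rewrite <- RtoC_inv by (apply pow_nonzero; specialize (Hpos n); lra).
    rewrite im_scal_r. reflexivity. }
  assert (HS : forall m, S_ (S m) = S_ m + Im (u (S m))).
  { intros m. unfold S_. rewrite sum_Sn. reflexivity. }
  assert (Hu1 : forall n, Rabs (Im (u n)) <= Rabs (Im z)).
  { intros n. rewrite Hu. pose proof (Hpos n).
    assert (H1 : 1 <= INR (S n)) by (rewrite S_INR; pose proof (pos_INR n); lra).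
    rewrite Rabs_div by (apply pow_nonzero; lra).
    rewrite (Rabs_pos_eq (_ ^ 2)) by (apply pow_le; lra).
    apply Rle_div_l; [apply pow_lt; lra|].
    eapply Rle_trans; [apply Rabs_Im_pow, Hz|].
    set (k := INR (S n)) in *.
    replace (Rabs (Im z) * k ^ 2) with (k * Rabs (Im z) * k) by ring.
    assert (0 <= k * Rabs (Im z)) by (apply Rmult_le_pos; lra). nra. }
  assert (Hu2 : forall n, Rabs (Im (u (S n))) <= / INR (S n) - / INR (S (S n))).
  { intros n. rewrite Hu. pose proof (Hpos n). pose proof (Hpos (S n)).
    rewrite Rabs_div by (apply pow_nonzero; lra).
    rewrite (Rabs_pos_eq (_ ^ 2)) by (apply pow_le; lra).
    apply Rle_trans with (1 / INR (S (S n)) ^ 2).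
    - apply Rmult_le_compat_r.
      + apply Rlt_le, Rinv_0_lt_compat, pow_lt. lra.
      + eapply Rle_trans; [apply Rabs_Im_le_Cmod | apply Cmod_pow_le_1, Hz].
    - rewrite (S_INR (S n)) in *. set (x := INR (S n)) in *.
      replace (/ x - / (x + 1)) with (1 / (x * (x + 1))) by (field; lra).
      apply Rmult_le_compat_l; [lra|]. apply Rinv_le_contravar; nra. }
  assert (Hlow : forall m, Rabs (S_ m) <= INR (S m) * Rabs (Im z)).
  { induction m as [|m IH].
    - unfold S_. rewrite sum_O. simpl INR. specialize (Hu1 O). lra.
    - rewrite HS. eapply Rle_trans; [apply Rabs_triang|].
      rewrite (S_INR (S m)). specialize (Hu1 (S m)). lra. }
  (* [S_ (pred N)] has exactly [N] terms. The subtracted [/ INR (N + k)] is what makes the induction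
     telescope. *)
  assert (Hhigh : forall k, Rabs (S_ (pred N + k)%nat)
            <= INR N * Rabs (Im z) + / INR N - / INR (N + k)).
  { induction k as [|k IH].
    - rewrite !Nat.add_0_r. eapply Rle_trans; [apply Hlow|].
      replace (S (pred N)) with N by lia. lra.
    - replace (pred N + S k)%nat with (S (pred N + k)) by lia.
      rewrite HS. eapply Rle_trans; [apply Rabs_triang|].
      specialize (Hu2 (pred N + k)%nat).
      replace (S (pred N + k)) with (N + k)%nat in * by lia.
      replace (N + S k)%nat with (S (N + k)) by lia. lra. }
  change (Rabs (S_ M) <= INR N * Rabs (Im z) + / INR N).
  destruct (Nat.le_gt_cases N M) as [HNM|HNM].
  - specialize (Hhigh (M - pred N)%nat).
    replace (pred N + (M - pred N))%nat with M in Hhigh by lia.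
    assert (0 < / INR (N + (M - pred N))).
    { apply Rinv_0_lt_compat, lt_0_INR. lia. }
    lra.
  - eapply Rle_trans; [apply Hlow|].
    assert (INR (S M) <= INR N) by (apply le_INR; lia).
    assert (0 < / INR N) by (apply Rinv_0_lt_compat; lra).
    nra.
Qed.

Lemma Rabs_Im_dilog_disc (L : C -> C) (z : C) (N : nat) :
  is_dilogarithm L -> Cmod z <= 1 -> (0 < N)%nat ->
  Rabs (Im (L z)) <= INR N * Rabs (Im z) + / INR N.
Proof.
  intros HL Hz HN.
  pose proof (dilogarithm_series L HL z Hz) as Hs.
  assert (Hlim : is_lim_seq
    (fun M => Rabs (Im (sum_n (G := C_NormedModule)
       (fun n => (z ^ S n / RtoC (INR (S n) ^ 2))%C) M))) (Rabs (Im (L z)))).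
  { apply (is_lim_seq_abs _ (Finite (Im (L z)))).
    apply (filterlim_comp _ _ _ _ (fun w : C => Im w) _ _ (locally (Im (L z))) Hs).
    apply (continuous_snd (U := R_UniformSpace) (V := R_UniformSpace)). }
  apply (is_lim_seq_le _ _ _ _
    (fun M => Rabs_Im_sum_dilog z N M Hz HN) Hlim (is_lim_seq_const _)).
Qed.

(** * Derivative of [psi] and its size near 0 *)

Lemma Cmod_Log_le (z : C) : z <> 0%C -> Cmod (Log z) <= Rabs (ln (Cmod z)) + PI.
Proof.
  intros Hz. destruct (Arg_polar z Hz) as [HA _].
  replace (Log z) with (RtoC (ln (Cmod z)) + Ci * Arg z)%C
    by (apply injective_projections; simpl; ring).
  eapply Rle_trans; [apply Cmod_triangle|].
  rewrite Cmod_mult, Cmod_Ci, !Cmod_R.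
  assert (Rabs (Arg z) <= PI) by (apply Rabs_le; lra). lra.
Qed.

(** At [z = 1 + i a] one has [1 - z = - i a], whose principal logarithm is [ln a - i PI / 2]. The
    derivative is the imaginary part of [- i (ln a - i PI / 2) / (1 + i a)]. *)
Lemma is_derive_psi (L : C -> C) (a : R) :
  is_dilogarithm L -> 0 < a ->
  is_derive (psi L) a ((PI * a / 2 - ln a) / (1 + a ^ 2)).
Proof.
  intros HL Ha.
  assert (Hz : (1 + Ci * a)%C = (1, a)).
  { apply injective_projections; simpl; ring. }
  assert (Hs : slit (1 + Ci * a)%C) by (rewrite Hz; intros [_ H]; simpl in H; lra).
  assert (Hn : (1 + Ci * a)%C <> 0%C).
  { rewrite Hz. intros H. apply (f_equal fst) in H. simpl in H. lra. }
  pose proof (is_derive_Im_line L 1%C Ci _ a (dilogarithm_derive L HL _ Hs Hn)) as H.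
  eapply is_derive_ext in H; [|intros; reflexivity].
  evar_last; [exact H|].
  assert (Hm : (1 - (1 + Ci * a))%C = (0, -a)).
  { apply injective_projections; simpl; ring. }
  rewrite Hm, Hz.
  assert (HC : Cmod (0, - a) = a).
  { unfold Cmod; simpl. replace (0 * (0 * 1) + - a * (- a * 1)) with (a * a) by ring.
    apply sqrt_square; lra. }
  assert (HLog : Log (0, -a) = (ln a, - (PI / 2))).
  { unfold Log, Arg. rewrite HC. f_equal. simpl.
    destruct (Rle_dec 0 (-a)); [lra|].
    replace (0 / a) with 0 by (field; lra). rewrite acos_0. lra. }
  rewrite HLog. unfold Cdiv, Cinv, Ci, Cmult, Copp; simpl. field.
  nra.
Qed.

(* The mean value theorem moves [1 + i a] horizontally to [1 - a + i a], which
   lies in the closed unit disc, where the series applies. *)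
Lemma Rabs_psi_le (L : C -> C) (a : R) (N : nat) :
  is_dilogarithm L -> 0 < a <= 1 / 2 -> (0 < N)%nat ->
  Rabs (psi L a) <= 2 * a * (PI - ln a) + INR N * a + / INR N.
Proof.
  intros HL Ha HN.
  set (h := fun t : R => Im (L (Ci * a + 1 * t)%C)).
  assert (Hz : forall t : R, (Ci * a + 1 * t)%C = (t, a)).
  { intros; apply injective_projections; simpl; ring. }
  assert (Hder : forall t : R, is_derive h t
    (Im (- (Log (1 - (t, a)) / (t, a)))%C)).
  { intros t.
    assert (Hs : slit (Ci * a + 1 * t)%C) by (rewrite Hz; intros [_ H]; simpl in H; lra).
    assert (Hn : (Ci * a + 1 * t)%C <> 0%C).
    { rewrite Hz. intros H. apply (f_equal snd) in H. simpl in H. lra. }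
    pose proof (is_derive_Im_line L (Ci * a)%C 1%C _ t
      (dilogarithm_derive L HL _ Hs Hn)) as H.
    rewrite Cmult_1_l, Hz in H. exact H. }
  destruct (MVT_gen h (1 - a) 1 _ (fun t _ => Hder t)) as [t [Ht Hmv]].
  { intros t _. apply continuity_pt_filterlim.
    apply (ex_derive_continuous (V := R_NormedModule)).
    eexists; apply Hder. }
  rewrite Rmin_left, Rmax_right in Ht by lra.
  assert (Hpsi : psi L a = h 1).
  { unfold psi, h. do 2 f_equal. ring. }
  assert (Hend : Rabs (h (1 - a)) <= INR N * a + / INR N).
  { unfold h. rewrite Hz.
    replace (INR N * a) with (INR N * Rabs (Im (1 - a, a)))
      by (simpl; rewrite Rabs_pos_eq; lra).
    apply Rabs_Im_dilog_disc; auto.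
    (* The endpoint is in the disc because [(1 - a) ^ 2 + a ^ 2 <= 1] for [0 < a <= 1]. *)
    apply Rsqr_incr_0; [|apply Cmod_ge_0|lra].
    pose proof (Cmod2_alt (1 - a, a)) as H. simpl in H. unfold Rsqr. nra. }
  assert (Hm : (1 - (t, a))%C = (1 - t, - a)).
  { apply injective_projections; simpl; ring. }
  rewrite Hm in Hmv.
  assert (Hn : (1 - t, - a) <> RtoC 0).
  { intros H. apply (f_equal snd) in H. simpl in H. lra. }
  assert (Hn' : (t, a) <> RtoC 0).
  { intros H. apply (f_equal snd) in H. simpl in H. lra. }
  assert (HC1 : a <= Cmod (1 - t, - a)).
  { pose proof (Rabs_Im_le_Cmod (1 - t, - a)) as H. simpl in H.
    rewrite Rabs_left in H by lra. lra. }
  assert (HC2 : Cmod (1 - t, - a) <= 1).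
  { apply Rsqr_incr_0; [|apply Cmod_ge_0|lra].
    pose proof (Cmod2_alt (1 - t, - a)) as H. simpl in H. unfold Rsqr. nra. }
  assert (HC3 : 1 / 2 <= Cmod (t, a)).
  { pose proof (re_le_Cmod (t, a)) as H. simpl in H.
    rewrite Rabs_pos_eq in H by lra. lra. }
  assert (Hln1 : ln a <= ln (Cmod (1 - t, - a))) by (apply ln_le; lra).
  assert (Hln2 : ln (Cmod (1 - t, - a)) <= 0) by (rewrite <- ln_1; apply ln_le; lra).
  pose proof (Cmod_Log_le _ Hn) as HLog.
  rewrite Rabs_left1 in HLog by lra.
  set (D := (- (Log (1 - t, - a)%R / (t, a)))%C) in *.
  (* The numerator is at most [PI - ln a], since [a <= Cmod (1 - t, - a) <= 1]. The factor 2 comes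
     from [Cmod (t, a) >= 1 / 2]. *)
  assert (HD : Rabs (Im D) <= 2 * (PI - ln a)).
  { eapply Rle_trans; [apply Rabs_Im_le_Cmod|].
    unfold D. rewrite Cmod_opp, Cmod_div by exact Hn'.
    apply Rle_div_l; [lra|]. pose proof PI_RGT_0.
    pose proof (Cmod_ge_0 (Log (1 - t, - a))). nra. }
  rewrite Hpsi. replace (h 1) with (Im D * a + h (1 - a)) by lra.
  eapply Rle_trans; [apply Rabs_triang|].
  rewrite Rabs_mult, (Rabs_pos_eq a) by lra. nra.
Qed.

(** * The inverse tangent integral *)

Lemma atan_nonneg (x : R) : 0 <= x -> 0 <= atan x.
Proof.
  intros [H| <-]; [|rewrite atan_0; lra].
  apply Rlt_le. rewrite <- atan_0. apply atan_increasing, H.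
Qed.

Lemma atan_le_id (x : R) : 0 <= x -> atan x <= x.
Proof.
  intros [H| <-]; [|rewrite atan_0; lra].
  destruct (MVT_gen atan 0 x (fun y => / (1 + Rsqr y))) as [c [Hc E]].
  - intros y _. apply is_derive_atan.
  - intros y _. apply continuity_pt_filterlim.
    apply (ex_derive_continuous (V := R_NormedModule)).
    eexists; apply (is_derive_atan y).
  - rewrite atan_0, !Rminus_0_r in E. rewrite E.
    assert (/ (1 + Rsqr c) <= 1).
    { rewrite <- Rinv_1. apply Rinv_le_contravar; pose proof (Rle_0_sqr c); lra. }
    nra.
Qed.

(** The raw quotient takes the default value 0 at 0 and is discontinuous there; the value 1 removes
    the singularity. *)
Definition atanc (x : R) : R := if Req_EM_T x 0 then 1 else atan x / x.

Lemma continuous_atanc (x : R) : continuous atanc x.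
Proof.
  destruct (Req_EM_T x 0) as [-> | Hx].
  - intros P [eps HP].
    (* Continuity at 0 is exactly [atan' 0 = 1]: the quotient [atan y / y] is the difference
       quotient of [atan] at 0. *)
    assert (Hd : derivable_pt_lim atan 0 1).
    { apply is_derive_Reals. evar_last; [apply is_derive_atan|].
      unfold Rsqr. simpl. field. }
    destruct (Hd eps (cond_pos eps)) as [del Hdel].
    exists del. intros y Hy. apply HP.
    change (Rabs (atanc y - atanc 0) < eps). unfold atanc.
    destruct (Req_EM_T 0 0) as [_|]; [|lra].
    destruct (Req_EM_T y 0) as [_|Hy0].
    + rewrite Rminus_diag, Rabs_R0. apply cond_pos.
    + change (Rabs (y - 0) < del) in Hy. rewrite Rminus_0_r in Hy.
      specialize (Hdel y Hy0 Hy). rewrite Rplus_0_l, atan_0, Rminus_0_r in Hdel.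
      exact Hdel.
  - apply continuous_ext_loc with (fun y => atan y / y).
    + assert (Hp : 0 < Rabs x) by (apply Rabs_pos_lt, Hx).
      exists (mkposreal _ Hp). intros y Hy.
      change (Rabs (y - x) < Rabs x) in Hy. unfold atanc.
      destruct (Req_EM_T y 0) as [->|]; [|reflexivity].
      rewrite Rminus_0_l, Rabs_Ropp in Hy. lra.
    + apply (ex_derive_continuous (V := R_NormedModule) (fun y => atan y / y)).
      auto_derive. exact Hx.
Qed.

Lemma Ti2_atanc (y : R) : Ti2 y = RInt atanc 0 y.
Proof.
  apply RInt_ext. intros x Hx. unfold atanc.
  destruct (Req_EM_T x 0) as [->|]; [|reflexivity].
  exfalso. destruct (Rle_dec 0 y).
  - rewrite Rmin_left in Hx; lra.
  - rewrite Rmax_left in Hx; lra.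
Qed.

Lemma ex_RInt_atanc (a b : R) : ex_RInt atanc a b.
Proof. apply (ex_RInt_continuous (V := R_CompleteNormedModule)). intros; apply continuous_atanc. Qed.

Lemma is_derive_Ti2 (y : R) : 0 < y -> is_derive Ti2 y (atan y / y).
Proof.
  intros Hy.
  apply is_derive_ext with (RInt atanc 0).
  { intros; symmetry; apply Ti2_atanc. }
  replace (atan y / y) with (atanc y)
    by (unfold atanc; destruct (Req_EM_T y 0); [lra | reflexivity]).
  apply (is_derive_RInt (V := R_NormedModule) _ _ 0 y).
  - apply filter_forall. intros b.
    apply (RInt_correct (V := R_CompleteNormedModule)), ex_RInt_atanc.
  - apply continuous_atanc.
Qed.

(** The integrand lies in (0, 1]. This serves both for the decay as [y] tends to 0 and, at [y = 1],
    for showing that 1 belongs to [calA]. *)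
Lemma Ti2_bounds (y : R) : 0 < y -> 0 < Ti2 y <= y.
Proof.
  intros Hy. rewrite Ti2_atanc. split.
  - apply RInt_gt_0; [exact Hy | | intros; apply continuous_atanc].
    intros x Hx. unfold atanc. destruct (Req_EM_T x 0); [lra|].
    apply Rdiv_lt_0_compat; [|lra].
    rewrite <- atan_0. apply atan_increasing; lra.
  - apply Rle_trans with (RInt (fun _ => 1) 0 y).
    + apply RInt_le; [lra | apply ex_RInt_atanc | apply ex_RInt_const|].
      intros x Hx. unfold atanc. destruct (Req_EM_T x 0); [lra|].
      apply Rle_div_l; [lra|]. rewrite Rmult_1_l. apply atan_le_id. lra.
    + rewrite RInt_const. unfold scal; simpl; unfold mult; simpl. lra.
Qed.

(** * A continuous form of the integrand *)

(* With [t = arg (a + exp (i x))] the integrand is [PI / 2 - t].  The first case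
   uses [a + exp (i x) = exp (i x) * (1 + a * exp (- i x))].  Unlike [integrand],
   this is continuous on the whole line, at the cost of a case split on [a]. *)
Definition integrandc (a x : R) : R :=
  if Rlt_dec a 1 then PI / 2 - x + atan (a * sin x / (1 + a * cos x))
  else if Rlt_dec 1 a then PI / 2 - atan (sin x / (a + cos x))
  else PI / 2 - x / 2.

Lemma continuous_integrandc (a x : R) : 0 < a -> continuous (integrandc a) x.
Proof.
  intros Ha. pose proof (COS_bound x).
  unfold integrandc.
  destruct (Rlt_dec a 1); [|destruct (Rlt_dec 1 a)].
  - apply (ex_derive_continuous (V := R_NormedModule) (fun x => _)). auto_derive. nra.
  - apply (ex_derive_continuous (V := R_NormedModule) (fun x => _)). auto_derive. nra.
  - apply (ex_derive_continuous (V := R_NormedModule) (fun x => _)). auto_derive. trivial.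
Qed.

Lemma atan_cot (x : R) : 0 < x < PI -> atan (cos x / sin x) = PI / 2 - x.
Proof.
  intros Hx. rewrite <- (atan_tan (PI / 2 - x)) by lra. f_equal.
  unfold tan. rewrite sin_shift, cos_shift. reflexivity.
Qed.

(** This excludes a branch jump in the arctangent subtraction formula: the difference lies in (0,
    PI), and its cosine is [cos (atan u) * cos (atan v) * (1 + u * v) > 0]. *)
Lemma atan_sub_lt_PI2 (u v : R) :
  v < u -> 0 < 1 + u * v -> atan u - atan v < PI / 2.
Proof.
  intros Huv Hp.
  pose proof (atan_bound u). pose proof (atan_bound v).
  apply Rnot_le_lt. intros H1.
  assert (Hc : cos (atan u - atan v) <= 0) by (apply cos_le_0; lra).
  assert (Hu : 0 < cos (atan u)) by (apply cos_gt_0; lra).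
  assert (Hv : 0 < cos (atan v)) by (apply cos_gt_0; lra).
  assert (Eu : sin (atan u) = u * cos (atan u)).
  { rewrite <- (tan_atan u) at 2. unfold tan. field. lra. }
  assert (Ev : sin (atan v) = v * cos (atan v)).
  { rewrite <- (tan_atan v) at 2. unfold tan. field. lra. }
  rewrite cos_minus, Eu, Ev in Hc.
  assert (0 < cos (atan u) * cos (atan v) * (1 + u * v))
    by (repeat apply Rmult_lt_0_compat; assumption).
  nra.
Qed.

(** For [a < 1], subtract [atan (cos x / sin x) = PI / 2 - x]; there is no jump because
    [1 + a * cos x > 0]. For [a > 1], [a + cos x > 0] allows [atan (/ y) = PI / 2 - atan y]. For
    [a = 1], the quotient is the cotangent of [x / 2]. *)
Lemma integrandc_eq (a x : R) : 0 < a -> 0 < x < PI -> integrandc a x = integrand a x.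
Proof.
  intros Ha Hx. unfold integrand.
  destruct (Req_EM_T x 0); [lra|]. destruct (Req_EM_T x PI); [lra|].
  assert (Hs : 0 < sin x) by (apply sin_gt_0; lra).
  pose proof (COS_bound x) as Hc.
  pose proof (sin2_cos2 x) as Hsc. unfold Rsqr in Hsc.
  unfold integrandc. destruct (Rlt_dec a 1); [|destruct (Rlt_dec 1 a)].
  - set (u := (a + cos x) / sin x). set (v := cos x / sin x).
    assert (E : 1 + u * v = (1 + a * cos x) / (sin x * sin x)).
    { unfold u, v. field_simplify; [|lra..].
      replace (sin x ^ 2) with (1 - cos x * cos x) by nra.
      f_equal. nra. }
    assert (Hp : 0 < 1 + u * v) by (rewrite E; apply Rdiv_lt_0_compat; nra).
    assert (Huv : v < u).
    { unfold u, v. apply Rmult_lt_compat_r; [apply Rinv_0_lt_compat; lra | lra]. }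
    pose proof (atan_sub_lt_PI2 u v Huv Hp).
    pose proof (atan_increasing v u Huv). pose proof PI_RGT_0.
    rewrite (atan_sub_correct u v);
      [| lra | lra | apply atan_bound].
    unfold v at 1. rewrite atan_cot by exact Hx. do 2 f_equal.
    unfold atan_sub. rewrite E. unfold u, v. field. split; nra.
  - replace ((a + cos x) / sin x) with (/ (sin x / (a + cos x))) by (field; lra).
    symmetry. apply atan_inv. apply Rdiv_lt_0_compat; lra.
  - replace a with 1 by lra.
    replace (PI / 2 - x / 2) with (atan (cos (x / 2) / sin (x / 2)))
      by (rewrite atan_cot by lra; lra).
    f_equal.
    assert (Hs2 : 0 < sin (x / 2)) by (apply sin_gt_0; lra).
    assert (Hc2 : 0 < cos (x / 2)) by (apply cos_gt_0; lra).
    replace x with (2 * (x / 2)) at 3 4 by field.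
    rewrite sin_2a, cos_2a_cos. field. lra.
Qed.

(** * Monotonicity of [phi a] and the solution of [phi a b = y] *)

(** With the everywhere continuous [integrandc], this is differentiable on the whole line, so
    [IVT_gen] and the mean value theorem apply without care at 0 and [PI]. *)
Definition phic (a b : R) : R := RInt (integrandc a) 0 b - PI * b / 2 + b ^ 2 / 2.

Lemma phic_eq (a b : R) : 0 < a -> 0 <= b <= PI -> phic a b = phi a b.
Proof.
  intros Ha Hb. unfold phic, phi, Iab. do 2 f_equal.
  apply RInt_ext. rewrite Rmin_left, Rmax_right by lra.
  intros x Hx. apply integrandc_eq; lra.
Qed.

Lemma is_derive_phic (a b : R) : 0 < a ->
  is_derive (phic a) b (integrandc a b - PI / 2 + b).
Proof.
  intros Ha.
  assert (H : is_derive (RInt (integrandc a) 0) b (integrandc a b)).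
  { apply (is_derive_RInt (V := R_NormedModule) _ _ 0 b).
    - apply filter_forall. intros c.
      apply (RInt_correct (V := R_CompleteNormedModule)).
      apply (ex_RInt_continuous (V := R_CompleteNormedModule)).
      intros; apply continuous_integrandc, Ha.
    - apply continuous_integrandc, Ha. }
  assert (H2 : is_derive (fun b => - PI * b / 2 + b ^ 2 / 2) b (- PI / 2 + b)).
  { auto_derive; [trivial | field]. }
  pose proof (is_derive_plus (V := R_NormedModule) _ _ _ _ _ H H2) as H3.
  replace (integrandc a b - PI / 2 + b) with (plus (integrandc a b) (- PI / 2 + b))
    by (unfold plus; simpl; field).
  eapply is_derive_ext; [|exact H3].
  intros t. unfold phic, plus; simpl. field.
Qed.


Lemma phic_increasing (a b c : R) :
  0 < a -> 0 <= b -> b < c -> c <= PI -> phic a b < phic a c.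
Proof.
  intros Ha Hb Hbc Hc.
  destruct (MVT_cor2 (phic a) (fun x => integrandc a x - PI / 2 + x) b c Hbc)
    as [x [E Hx]].
  { intros x _. apply is_derive_Reals, is_derive_phic, Ha. }
  (* The mean value point is strictly between [b] and [c], hence inside (0, PI) even when [b = 0] or
     [c = PI]. *)
  assert (Hs : 0 < sin x) by (apply sin_gt_0; lra).
  assert (H : atan (cos x / sin x) < atan ((a + cos x) / sin x)).
  { apply atan_increasing, Rmult_lt_compat_r; [apply Rinv_0_lt_compat; lra | lra]. }
  rewrite atan_cot in H by lra.
  rewrite integrandc_eq in E by lra. unfold integrand in E.
  destruct (Req_EM_T x 0); [lra|]. destruct (Req_EM_T x PI); [lra|].
  nra.
Qed.

Lemma phic_0 (a : R) : phic a 0 = 0.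
Proof. unfold phic. rewrite RInt_point. unfold zero; simpl. field. Qed.

(** For [a = 1] the integrand is [PI / 2 - x / 2], so [phic 1] has derivative [x / 2] and equals
    [x ^ 2 / 4]. *)
Lemma phi_1_PI : phi 1 PI = PI ^ 2 / 4.
Proof.
  pose proof PI_RGT_0.
  rewrite <- phic_eq by lra.
  destruct (MVT_cor2 (fun x => phic 1 x - x ^ 2 / 4) (fun _ => 0) 0 PI) as [x [E Hx]].
  - lra.
  - intros x _. apply is_derive_Reals.
    evar_last.
    + apply (is_derive_minus (V := R_NormedModule)).
      * apply is_derive_phic. lra.
      * auto_derive; [trivial | reflexivity].
    + unfold integrandc. destruct (Rlt_dec 1 1); [lra|].
      unfold minus, plus, opp; simpl. field.
  - rewrite phic_0 in E. lra.
Qed.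

Lemma exists_unique_phi_eq (a y : R) :
  0 < a -> 0 < y < phi a PI -> exists! b, 0 < b < PI /\ phi a b = y.
Proof.
  intros Ha Hy. pose proof PI_RGT_0.
  rewrite <- phic_eq in Hy by lra.
  destruct (IVT_gen (phic a) 0 PI y) as [b [Hb E]].
  - intros b. apply continuity_pt_filterlim.
    apply (ex_derive_continuous (V := R_NormedModule)).
    eexists; apply is_derive_phic, Ha.
  - rewrite phic_0, Rmin_left, Rmax_right; lra.
  - rewrite Rmin_left, Rmax_right in Hb by lra.
    exists b. split.
    + rewrite <- phic_eq by lra. split; [|exact E].
      (* The endpoints are excluded because [y] differs from both endpoint values, 0 and
         [phic a PI]. *)
      split; apply Rnot_le_lt; intros H1.
      * replace b with 0 in E by lra. rewrite phic_0 in E. lra.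
      * replace b with PI in E by lra. lra.
    + intros c [Hc Ec]. rewrite <- phic_eq in Ec by lra.
      destruct (Rtotal_order b c) as [H1|[H1|H1]]; [|exact H1|].
      * pose proof (phic_increasing a b c Ha). lra.
      * pose proof (phic_increasing a c b Ha). lra.
Qed.

(** * Identification of [psi] with a real expression *)

(** Along [a = s ^ 2] this gives [- a * ln a <= 2 * s], an explicit rate for the logarithmic terms.
    It is [1 + t <= exp t] at [t = ln (/ s)]. *)
Lemma opp_ln_sqr_le (s : R) : 0 < s -> - ln (s ^ 2) <= 2 / s.
Proof.
  intros Hs.
  assert (H : 1 + ln (/ s) <= / s).
  { rewrite <- (exp_ln (/ s)) at 2 by (apply Rinv_0_lt_compat, Hs). apply exp_ineq1_le. }
  rewrite ln_Rinv in H by exact Hs.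
  replace (s ^ 2) with (s * s) by ring. rewrite ln_mult by exact Hs.
  unfold Rdiv. lra.
Qed.

Definition psi_real (a : R) : R := Ti2 a - atan a * ln a + PI / 4 * ln (a ^ 2 + 1).

(** The two contributions [atan a / a], from [Ti2] and from [atan a * ln a], cancel. *)
Lemma is_derive_psi_real (a : R) : 0 < a ->
  is_derive psi_real a ((PI * a / 2 - ln a) / (1 + a ^ 2)).
Proof.
  intros Ha. unfold psi_real.
  evar_last.
  - apply (is_derive_plus (V := R_NormedModule)).
    + apply (is_derive_minus (V := R_NormedModule)).
      * apply is_derive_Ti2, Ha.
      * apply (is_derive_mult atan ln a).
        -- apply is_derive_atan.
        -- apply is_derive_ln, Ha.
        -- intros; apply Rmult_comm.
    + assert (H : is_derive (fun x => PI / 4 * ln (x ^ 2 + 1)) a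
        (PI / 2 * a / (1 + a ^ 2))).
      { auto_derive; [nra | field; nra]. }
      exact H.
  - unfold minus, plus, opp, mult; simpl. unfold Rsqr. field. nra.
Qed.

Lemma ln_le_minus_1 (x : R) : 0 < x -> ln x <= x - 1.
Proof.
  intros Hx. pose proof (exp_ineq1_le (ln x)) as H.
  rewrite exp_ln in H by exact Hx. lra.
Qed.

Lemma Rabs_psi_real_le (a : R) : 0 < a <= 1 -> Rabs (psi_real a) <= 2 * a - a * ln a.
Proof.
  intros Ha. unfold psi_real.
  pose proof (Ti2_bounds a (proj1 Ha)).
  pose proof (atan_le_id a). pose proof (atan_nonneg a).
  assert (ln a <= 0) by (rewrite <- ln_1; apply ln_le; lra).
  assert (0 <= ln (a ^ 2 + 1)) by (rewrite <- ln_1; apply ln_le; nra).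
  assert (ln (a ^ 2 + 1) <= a ^ 2) by (pose proof (ln_le_minus_1 (a ^ 2 + 1)); nra).
  pose proof PI_4. pose proof PI_RGT_0.
  assert (0 <= PI / 4 * ln (a ^ 2 + 1) <= a ^ 2) by nra.
  assert (0 <= - (atan a * ln a) <= - (a * ln a)) by nra.
  (* The three terms are at most [a], [- a * ln a] and [a ^ 2 <= a]. *)
  apply Rabs_le. nra.
Qed.

Lemma psi_eq_psi_real (L : C -> C) (a : R) :
  is_dilogarithm L -> 0 < a -> psi L a = psi_real a.
Proof.
  intros HL Ha.
  set (D := fun x => psi L x - psi_real x).
  assert (HD : forall x, 0 < x -> is_derive D x 0).
  { intros x Hx. evar_last.
    - apply (is_derive_minus (V := R_NormedModule)).
      + apply is_derive_psi; eassumption.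
      + apply is_derive_psi_real, Hx.
    - unfold minus, plus, opp; simpl. ring. }
  assert (Hc : forall x y, 0 < x -> x < y -> D x = D y).
  { intros x y Hx Hxy. apply (eq_is_derive (V := R_NormedModule)); [|exact Hxy].
    intros t Ht. apply HD. lra. }
  assert (Hc' : forall x, 0 < x -> D x = D a).
  { intros x Hx. destruct (Rtotal_order x a) as [H|[->|H]]; [|reflexivity|];
    [|symmetry]; apply Hc; auto. }
  (* [D] is constant, so it may be evaluated at [s ^ 2] with [s = / INR n]. Choosing [N = n]
     balances the disc bound: [N * s ^ 2] and [/ N] both equal [s]. All other terms are also O(s),
     and 20 is a generous total. *)
  assert (Hb : forall n : nat, (2 <= n)%nat -> Rabs (D a) <= 20 * / INR n).
  { intros n Hn.
    assert (Hn2 : 2 <= INR n) by (apply (le_INR 2); exact Hn).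
    set (s := / INR n).
    assert (Hs : 0 < s <= 1 / 2).
    { unfold s. split; [apply Rinv_0_lt_compat; lra|].
      replace (1 / 2) with (/ 2) by field. apply Rinv_le_contravar; lra. }
    assert (Hs2 : 0 < s ^ 2 <= 1 / 2) by nra.
    rewrite <- (Hc' (s ^ 2)) by lra. unfold D.
    pose proof (Rabs_psi_le L (s ^ 2) n HL Hs2 ltac:(lia)) as H1.
    pose proof (Rabs_psi_real_le (s ^ 2) ltac:(lra)) as H2.
    fold s in H1. replace (INR n * s ^ 2) with s in H1 by (unfold s; field; lra).
    pose proof (opp_ln_sqr_le s (proj1 Hs)) as H3.
    assert (H4 : - (s ^ 2 * ln (s ^ 2)) <= 2 * s).
    { replace (2 * s) with (s ^ 2 * (2 / s)) by (field; lra).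
      replace (- (s ^ 2 * ln (s ^ 2))) with (s ^ 2 * - ln (s ^ 2)) by ring.
      apply Rmult_le_compat_l; lra. }
    eapply Rle_trans; [apply Rabs_triang|]. rewrite Rabs_Ropp.
    pose proof PI_4. nra. }
  assert (H0 : D a = 0).
  { apply Rabs_eq_0. apply Rle_antisym; [|apply Rabs_pos].
    apply (is_lim_seq_le_loc (fun _ => Rabs (D a)) (fun n => 20 * / INR n) (Rabs (D a)) 0).
    - exists 2%nat. exact Hb.
    - apply is_lim_seq_const.
    - replace (Finite 0) with (Rbar_mult 20 0) by (simpl; f_equal; ring).
      apply is_lim_seq_scal_l.
      apply (is_lim_seq_inv _ p_infty); [apply is_lim_seq_INR | discriminate]. }
  unfold D in H0. lra.
Qed.

Theorem theorem1 : forall Li2 : C -> C, is_dilogarithm Li2 ->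
  (exists a : R, calA Li2 a) /\
  (forall a : R, calA Li2 a ->
    exists! b : R, 0 < b < PI /\
      Ti2 a = atan a * ln a + Iab a b - PI * b / 2 + b ^ 2 / 2
              - PI / 4 * ln (a ^ 2 + 1)).
Proof.
  intros L HL. split.
  - exists 1. unfold calA. rewrite psi_eq_psi_real by (assumption || lra).
    rewrite phi_1_PI. unfold psi_real. rewrite ln_1.
    pose proof (Ti2_bounds 1 Rlt_0_1).
    assert (0 <= ln (1 ^ 2 + 1)) by (rewrite <- ln_1; apply ln_le; lra).
    (* With [ln 2 <= 1] and [Ti2 1 <= 1], it remains that [1 + PI / 4 < PI ^ 2 / 4], which follows
       from [PI > 3]. *)
    pose proof (ln_le_minus_1 (1 ^ 2 + 1)).
    pose proof PI_4. pose proof PI2_3_2. unfold PI2 in *.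
    repeat split; nra.
  - intros a [Ha Hpsi]. rewrite psi_eq_psi_real in Hpsi by assumption.
    destruct (exists_unique_phi_eq a _ Ha Hpsi) as [b [[Hb E] Hu]].
    exists b. unfold psi_real, phi in *. split.
    + split; [exact Hb | lra].
    + intros c [Hc Ec]. apply Hu. split; [exact Hc | lra].
Qed.
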